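(* Let $m\geq 2$ be an integer. Then \[ d_i(m+1)> \frac{4m^2+7m+i+3}{2(m+1-i)(m+1)}d_i(m), \qquad 1 \leq i \leq m-1, \] and \[ d_0(m+1)=\frac{4m+3}{2(m+1)}d_0(m),\qquad d_m(m+1)=\frac{(2m+3)(2m+1)}{2(m+1)}d_m(m) = \frac{(2m+3)(2m+1)}{2(m+1)}\, 2^{-m}\binom{2m}{m}. \]
   Context: For a nonnegative integer $m$ and $0\le i\le m$, the Boros-Moll coefficients are \[ d_i(m)=2^{-2m}\sum_{k=i}^m 2^k\binom{2m-2k}{m-k}\binom{m+k}{k}\binom{k}{i}. \] *)

(* Defs.v *)
From mathcomp Require Import all_boot all_order all_algebra.
Set Implicit Arguments.
Unset Strict Implicit.
Unset Printing Implicit Defensive.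
Import Order.TTheory GRing.Theory Num.Theory.
Local Open Scope ring_scope.

(* The Boros-Moll coefficient d_i(m); it is meaningful for 0 <= i <= m. *)
Definition boros_moll (i m : nat) : rat :=
  2 ^- (2 * m)
  * \sum_(i <= k < m.+1)
      2 ^+ k * 'C(2 * m - 2 * k, m - k)%:R * 'C(m + k, k)%:R * 'C(k, i)%:R.

(* Main.v *)
Require Import Defs.
From mathcomp Require Import all_boot all_order all_algebra.
From mathcomp Require Import ring lra zify.
Import Order.TTheory GRing.Theory Num.Theory.
Local Open Scope ring_scope.

(** Write d_i(m) as the sum over k of w(m,k) C(k,i). A Gosper-Zeilberger
    certificate yields
      2(m+1)(m+1-i) d_i(m+1) = (4m-2i+3)(m+i+1) d_i(m) - 2i(i+1) d_{i+1}(m),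
    which gives both equalities at i = 0 and i = m, and reduces the inequality to
    (i+1) d_{i+1}(m) < (m-i) d_i(m). The latter holds termwise because
    (i+1) C(k,i+1) = (k-i) C(k,i), with a strict gap at k = i < m. *)

Definition boros_moll_weight (m k : nat) : rat :=
  2 ^- (2 * m) * 2 ^+ k * 'C(2 * m - 2 * k, m - k)%:R * 'C(m + k, k)%:R.

Lemma boros_mollE (i m : nat) :
  boros_moll i m = \sum_(i <= k < m.+1) boros_moll_weight m k * 'C(k, i)%:R.
Proof.
rewrite /boros_moll big_distrr /=; apply: eq_bigr => k _.
by rewrite /boros_moll_weight !mulrA.
Qed.

Lemma boros_moll_weight_gt0 (m k : nat) : (k <= m)%N -> 0 < boros_moll_weight m k.
Proof.
move=> le_km; rewrite /boros_moll_weight.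
by rewrite !mulr_gt0 ?invr_gt0 ?exprn_gt0 ?ltr0n ?bin_gt0 //; lia.
Qed.

Lemma central_bin_rec (n : nat) :
  n.+1%:R * 'C(2 * n.+1, n.+1)%:R = 2 * (2 * n%:R + 1) * 'C(2 * n, n)%:R :> rat.
Proof.
have h1 : (n.+1 * 'C(2 * n.+1, n.+1) = 2 * n.+1 * 'C(2 * n + 1, n))%N.
  by rewrite -mul_bin_diag; congr (_ * 'C(_, _))%N; lia.
have h2 : (n.+1 * 'C(2 * n + 1, n) = (2 * n + 1) * 'C(2 * n, n))%N.
  have := mul_bin_down (2 * n + 1) n; rewrite addn1 /= => ->.
  by congr (_ * _)%N; lia.
rewrite -natrM h1 -mulnA h2 !natrM natrD natrM; ring.
Qed.

(** The difference is taken in [rat], so it is not truncated; for i > k+1 both binomials vanish. *)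
Lemma mulS_natr_bin (k i : nat) :
  (k.+1%:R - i%:R) * 'C(k.+1, i)%:R = k.+1%:R * 'C(k, i)%:R :> rat.
Proof.
case: (leqP i k.+1) => [le_ik | lt_ki].
  by rewrite -natrB // -!natrM -mul_bin_down.
by rewrite !bin_small ?mulr0 //; lia.
Qed.

Lemma mul_natr_binS (k i : nat) :
  i.+1%:R * 'C(k, i.+1)%:R = (k%:R - i%:R) * 'C(k, i)%:R :> rat.
Proof.
case: (leqP i k) => [le_ik | lt_ki].
  by rewrite -natrB // -!natrM mul_bin_left.
by rewrite !bin_small ?mulr0 //; lia.
Qed.

(** With n = m-k, raising m multiplies the power of two by 1/4, the central binomial C(2n,n) by
    2(2n+1)/(n+1), and C(m+k,k) by (m+k+1)/(m+1). *)
Lemma boros_moll_weightSl (m k : nat) : (k <= m)%N ->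
  2 * (m%:R + 1) * (m%:R - k%:R + 1) * boros_moll_weight m.+1 k =
  (2 * m%:R - 2 * k%:R + 1) * (m%:R + k%:R + 1) * boros_moll_weight m k.
Proof.
move=> le_km; rewrite /boros_moll_weight.
have [n ->] : exists n, m = (n + k)%N by exists (m - k)%N; lia.
have -> : (2 * (n + k).+1 - 2 * k = 2 * n.+1)%N by lia.
have -> : ((n + k).+1 - k = n.+1)%N by lia.
have -> : (2 * (n + k) - 2 * k = 2 * n)%N by lia.
have -> : (n + k - k = n)%N by lia.
have h := mulS_natr_bin (n + k + k) k.
have c := central_bin_rec n.
have -> : (2 * (n + k).+1 = (2 * (n + k)).+2)%N by lia.
rewrite addSn.
have -> : 2 ^+ (2 * (n + k)).+2 = 4 * 2 ^+ (2 * (n + k)) :> rat by rewrite !exprS; ring.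
set e := 2 ^+ (2 * (n + k)).
have e0 : e != 0 by rewrite expf_neq0.
transitivity (2 ^+ k / (2 * e) * (n.+1%:R * 'C(2 * n.+1, n.+1)%:R)
  * (((n + k + k).+1%:R - k%:R) * 'C((n + k + k).+1, k)%:R)).
  by rewrite -!natr1 !natrD; field.
by rewrite h c -!natr1 !natrD; field.
Qed.

(** The diagonal step fixes m-k, hence the central binomial. Only the powers of two and C(m+k,k)
    change, the latter by two absorption identities. *)
Lemma boros_moll_weightSS (m k : nat) : (k <= m)%N ->
  2 * (k%:R + 1) * (m%:R + 1) * boros_moll_weight m.+1 k.+1 =
  (m%:R + k%:R + 2) * (m%:R + k%:R + 1) * boros_moll_weight m k.
Proof.
move=> le_km; rewrite /boros_moll_weight.
have -> : (2 * m.+1 - 2 * k.+1 = 2 * m - 2 * k)%N by lia.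
rewrite subSS addSn addnS.
have hS : k.+1%:R * 'C((m + k).+2, k.+1)%:R =
          (m + k).+2%:R * 'C((m + k).+1, k)%:R :> rat.
  by rewrite -!natrM -mul_bin_diag.
have h := mulS_natr_bin (m + k) k.
have -> : (2 * m.+1 = (2 * m).+2)%N by lia.
have -> : 2 ^+ (2 * m).+2 = 4 * 2 ^+ (2 * m) :> rat by rewrite !exprS; ring.
set e := 2 ^+ (2 * m); set B := 'C(2 * m - 2 * k, m - k)%:R.
have e0 : e != 0 by rewrite expf_neq0.
transitivity (2 ^+ k / e * B * (m%:R + 1) * (k.+1%:R * 'C((m + k).+2, k.+1)%:R)).
  by rewrite -!natr1 exprS; field.
rewrite hS.
transitivity (2 ^+ k / e * B * (m + k).+2%:R
  * (((m + k).+1%:R - k%:R) * 'C((m + k).+1, k)%:R)).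
  by rewrite -!natr1 !natrD; field.
by rewrite h -!natr1 !natrD; field.
Qed.

Lemma boros_moll_rec (i m : nat) : (i <= m)%N ->
  2 * (m%:R + 1) * (m%:R + 1 - i%:R) * boros_moll i m.+1 =
  (4 * m%:R - 2 * i%:R + 3) * (m%:R + i%:R + 1) * boros_moll i m
  - 2 * i%:R * i.+1%:R * boros_moll i.+1 m.
Proof.
move=> le_im.
(* Since C(i,i+1) = 0, this sum may start at k = i. With the term k = m+1 of d_i(m+1) split off, all
   three sums run over the same range. *)
have -> : boros_moll i.+1 m =
    \sum_(i <= k < m.+1) boros_moll_weight m k * 'C(k, i.+1)%:R.
  by rewrite boros_mollE [RHS]big_ltn ?ltnS // bin_small // mulr0 add0r.
rewrite !boros_mollE big_nat_recr ?leqW //=.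
(* The certificate is a multiple of the summand for m+1, not for m, so that it
   also makes sense at the upper limit k = m+1. *)
pose G (k : nat) : rat := - 4 * (m%:R + 1) ^+ 2 * (k%:R - i%:R) / (m%:R + k%:R + 1)
  * (boros_moll_weight m.+1 k * 'C(k, i)%:R).
have GE k : (i <= k < m.+1)%N ->
    2 * (m%:R + 1) * (m%:R + 1 - i%:R) * (boros_moll_weight m.+1 k * 'C(k, i)%:R)
    - (4 * m%:R - 2 * i%:R + 3) * (m%:R + i%:R + 1)
      * (boros_moll_weight m k * 'C(k, i)%:R)
    + 2 * i%:R * i.+1%:R * (boros_moll_weight m k * 'C(k, i.+1)%:R) = G k.+1 - G k.
  rewrite ltnS => /andP[le_ik le_km].
  have m1 : m%:R + 1 != 0 :> rat by rewrite natr1 pnatr_eq0.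
  have k1 : k%:R + 1 != 0 :> rat by rewrite natr1 pnatr_eq0.
  have mk1 : m%:R + k%:R + 1 != 0 :> rat by rewrite -natrD natr1 pnatr_eq0.
  have mk2 : m%:R + k%:R + 2 != 0 :> rat by rewrite -!natrD pnatr_eq0 addn2.
  have n1 : m%:R - k%:R + 1 != 0 :> rat by rewrite -natrB // natr1 pnatr_eq0.
  have wl : boros_moll_weight m.+1 k = (2 * m%:R - 2 * k%:R + 1) * (m%:R + k%:R + 1)
      / (2 * (m%:R + 1) * (m%:R - k%:R + 1)) * boros_moll_weight m k.
    by rewrite mulrAC -boros_moll_weightSl //; field; rewrite m1 n1.
  have wS : boros_moll_weight m.+1 k.+1 = (m%:R + k%:R + 2) * (m%:R + k%:R + 1)
      / (2 * (k%:R + 1) * (m%:R + 1)) * boros_moll_weight m k.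
    by rewrite mulrAC -boros_moll_weightSS //; field; rewrite m1 k1.
  (* Absorption turns (k+1-i) C(k+1,i) into (k+1) C(k,i), and the diagonal weight ratio cancels the
     denominator m+k+2. *)
  have GS : G k.+1 = - 2 * (m%:R + 1) * (m%:R + k%:R + 1)
      * (boros_moll_weight m k * 'C(k, i)%:R).
    transitivity (- 4 * (m%:R + 1) ^+ 2 / (m%:R + k%:R + 2) * boros_moll_weight m.+1 k.+1
      * ((k.+1%:R - i%:R) * 'C(k.+1, i)%:R)).
      by rewrite /G -!natr1; field.
    by rewrite mulS_natr_bin wS -natr1; field; rewrite mk2 m1 k1.
  rewrite GS /G wl.
  (* Regrouping isolates (i+1) C(k,i+1) = (k-i) C(k,i); every term is then a rational function times
     w(m,k) C(k,i). *)
  transitivity (2 * (m%:R + 1 - i%:R) * (m%:R + 1) * ((2 * m%:R - 2 * k%:R + 1)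
      * (m%:R + k%:R + 1) / (2 * (m%:R + 1) * (m%:R - k%:R + 1))
      * boros_moll_weight m k * 'C(k, i)%:R)
    - (4 * m%:R - 2 * i%:R + 3) * (m%:R + i%:R + 1)
      * (boros_moll_weight m k * 'C(k, i)%:R)
    + 2 * i%:R * boros_moll_weight m k * (i.+1%:R * 'C(k, i.+1)%:R)).
    by field; rewrite n1 m1.
  by rewrite mul_natr_binS; field; rewrite mk1 n1 m1.
(* The lower boundary value [G i] vanishes through the factor k-i. *)
have sumG : \sum_(i <= k < m.+1) (G k.+1 - G k) = G m.+1.
  by rewrite telescope_sumr ?leqW // [G i]/G subrr mulr0 !mul0r subr0.
(* At k = m+1 the denominator is 2(m+1), so [G m.+1] is minus the contribution of the term split off
   from d_i(m+1), and the two cancel. *)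
have GmE : G m.+1 = - 2 * (m%:R + 1) * (m%:R + 1 - i%:R)
    * (boros_moll_weight m.+1 m.+1 * 'C(m.+1, i)%:R).
  rewrite /G -!natr1; field.
  by rewrite !natr1 -natrD natr1 pnatr_eq0.
move: sumG; rewrite -(eq_big_nat _ _ GE) GmE big_split sumrB -!mulr_sumr /=.
by move=> h; lra.
Qed.

Lemma boros_moll_succ_lt (i m : nat) : (i < m)%N ->
  i.+1%:R * boros_moll i.+1 m < (m%:R - i%:R) * boros_moll i m.
Proof.
move=> lt_im.
rewrite !boros_mollE [X in _ < _ * X]big_ltn ?ltnS 1?ltnW // mulrDr !mulr_sumr.
apply: ltr_pwDl.
  by rewrite binn mulr1 mulr_gt0 ?subr_gt0 ?ltr_nat // boros_moll_weight_gt0 // ltnW.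
apply: ler_sum_nat => k /andP[lt_ik le_km].
rewrite mulrCA mul_natr_binS [leRHS]mulrCA.
rewrite ler_wpM2l //; first exact: ltW (boros_moll_weight_gt0 _ _ _).
by rewrite ler_wpM2r // lerD2r ler_nat.
Qed.

Lemma boros_moll_diag (m : nat) : boros_moll m m = 2 ^- m * 'C(2 * m, m)%:R.
Proof.
rewrite boros_mollE big_nat1 binn mulr1 /boros_moll_weight !subnn bin0 mulr1.
have -> : (2 * m = m + m)%N by lia.
by rewrite exprD; field; rewrite expf_neq0.
Qed.

Theorem theorem2p2 (m : nat) (hm : (2 <= m)%N) :
  (forall i : nat, (1 <= i <= m - 1)%N ->
     boros_moll i (m + 1) >
       (4 * m%:R ^+ 2 + 7 * m%:R + i%:R + 3)
         / (2 * (m%:R + 1 - i%:R) * (m%:R + 1)) * boros_moll i m)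
  /\ boros_moll 0 (m + 1) =
       (4 * m%:R + 3) / (2 * (m%:R + 1)) * boros_moll 0 m
  /\ boros_moll m (m + 1) =
       (2 * m%:R + 3) * (2 * m%:R + 1) / (2 * (m%:R + 1)) * boros_moll m m
  /\ (2 * m%:R + 3) * (2 * m%:R + 1) / (2 * (m%:R + 1)) * boros_moll m m =
       (2 * m%:R + 3) * (2 * m%:R + 1) / (2 * (m%:R + 1))
         * (2 ^- m * 'C(2 * m, m)%:R).
Proof.
have m1 : m%:R + 1 != 0 :> rat by rewrite natr1 pnatr_eq0.
rewrite addn1; split => [i /andP[i_gt0 le_i]|].
  have lt_im : (i < m)%N by lia.
  have P : 0 < 2 * (m%:R + 1 - i%:R) * (m%:R + 1) :> rat.
    by rewrite !mulr_gt0 // ?natr1 ?subr_gt0 ?ltr_nat // ltnS ltnW.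
  rewrite mulrAC ltr_pdivrMr //.
  have := boros_moll_rec _ _ (ltnW lt_im).
  (* Strictness survives the factor 2i because i >= 1. The bound gives the stated numerator:
     (4m-2i+3)(m+i+1) - 2i(m-i) = 4m^2+7m+i+3. *)
  have : 2 * i%:R * (i.+1%:R * boros_moll i.+1 m) <
         2 * i%:R * ((m%:R - i%:R) * boros_moll i m).
    by rewrite ltr_pM2l ?boros_moll_succ_lt // mulr_gt0 // ltr0n.
  by move=> lt_rec rec; nra.
split; [|split].
(* At i = 0 the factor 2i removes d_1(m), and a common factor m+1 cancels. *)
- have /(canRL (mulKf _)) -> := boros_moll_rec _ _ (leq0n m); first by field.
  by rewrite subr0 !mulf_neq0.
(* At i = m the recurrence involves d_{m+1}(m), an empty sum, and the factor m+1-i equals 1. *)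
- have vanish : boros_moll m.+1 m = 0 by rewrite boros_mollE big_geq.
  have /(canRL (mulKf _)) -> := boros_moll_rec _ _ (leqnn m).
    by rewrite vanish; field; rewrite m1 addrAC subrr add0r.
  by rewrite addrAC subrr add0r !mulf_neq0.
- by rewrite boros_moll_diag.
Qed.
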